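(* Let $A\in\mathbb{R}^{n\times n}$ be a diagonal matrix with $\det(A)<0$ and let $\mathcal{C}\subseteq\pi_{\mathcal{T}}(\mathbb{B}_{\mathrm{op}}(n))$ be a nonempty closed convex set. Then $$\max_{X\in\mathrm{SO}(n)}\{\langle A,X\rangle:\pi_{\mathcal{T}}(X)\in\mathcal{C}\}\ \geq\ \left(1-\frac1n\right)\max_{X\in\mathbb{B}_{\mathrm{op}}(n)}\{\langle A,X\rangle:\pi_{\mathcal{T}}(X)\in\mathcal{C}\}+\frac1n\min_{X\in\mathbb{B}_{\mathrm{op}}(n)}\{\langle A,X\rangle:\pi_{\mathcal{T}}(X)\in\mathcal{C}\}.$$
   Context: $\mathrm{SO}(n)=\{X\in\mathbb{R}^{n\times n}: X^\intercal X=I,\ \det(X)=1\}$; $\mathbb{B}_{\mathrm{op}}(n)=\{X\in\mathbb{R}^{n\times n}:\|X\|_{\mathrm{op}}\le1\}$ is the operator norm (maximum singular value) ball. $\langle A,X\rangle=\operatorname{tr}(A^\intercal X)$. The map $\pi_{\mathcal{T}}:\mathbb{R}^{n\times n}\to\mathbb{R}^{\binom n2}$, $\pi_{\mathcal{T}}(X)=(X_{ij})_{i<j}$, is the projection onto the strictly upper triangular entries. *)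

(* Defs.v *)
From HB Require Import structures.
From mathcomp Require Import all_boot all_order all_algebra.
From mathcomp Require Import all_classical all_reals all_analysis.

Set Implicit Arguments.
Unset Strict Implicit.
Unset Printing Implicit Defensive.
Import Order.TTheory GRing.Theory Num.Theory.
Import numFieldNormedType.Exports.
Local Open Scope classical_set_scope.
Local Open Scope ring_scope.

Definition frobenius (R : realType) (n : nat) (A X : 'M[R]_n) : R :=
  \tr (A^T *m X).

Definition SO (R : realType) (n : nat) : set 'M[R]_n :=
  [set X | X^T *m X = 1%:M /\ \det X = 1].
Arguments SO : clear implicits.

Definition singular_values (R : realType) (n : nat) (X : 'M[R]_n) : set R :=
  [set s | 0 <= s /\ eigenvalue (X^T *m X) (s ^+ 2)].

(* The set of singular values is finite, and nonempty as soon as n > 0, so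
   that this supremum is the maximum singular value. *)
Definition op_norm (R : realType) (n : nat) (X : 'M[R]_n) : R :=
  sup (singular_values X).

Definition op_ball (R : realType) (n : nat) : set 'M[R]_n :=
  [set X | op_norm X <= 1].
Arguments op_ball : clear implicits.

Definition upper_pairs (n : nat) : {set 'I_n * 'I_n} :=
  [set p : 'I_n * 'I_n | (p.1 < p.2)%N]%SET.

Lemma card_upper_pairs (n : nat) : #|upper_pairs n| = 'C(n, 2).
Proof.
rewrite -bin2_sum big_mkord -sum1_card.
under eq_bigl do rewrite inE.
rewrite -(pair_big_dep xpredT (fun i j : 'I_n => (i < j)%N)
  (fun _ _ => 1%N)) /=.
rewrite (exchange_big_dep xpredT) //=; apply: eq_bigr => j _.
rewrite sum1_card -[RHS](card_ord j).
have wj : injective (widen_ord (ltnW (ltn_ord j))).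
  by move=> a b /(congr1 val) /= ab; apply: val_inj.
rewrite -(fintype.card_image wj); apply: eq_card => i.
apply/idP/fintype.imageP => [ij|[k _ ->]].
  by exists (Ordinal ij) => //; apply: val_inj.
exact: (ltn_ord k).
Qed.

(* R^(n choose 2) is a space of row vectors; its k-th coordinate corresponds
   to the k-th pair in the enumeration of the pairs (i, j) with i < j. *)
Definition upper_pair (n : nat) (k : 'I_('C(n, 2))) : 'I_n * 'I_n :=
  enum_val (cast_ord (esym (card_upper_pairs n)) k).

Definition pi_T (R : realType) (n : nat) (X : 'M[R]_n) : 'rV[R]_('C(n, 2)) :=
  \row_k X (upper_pair k).1 (upper_pair k).2.

Definition is_max (R : realType) (E : set R) (m : R) : Prop :=
  E m /\ ubound E m.

Definition is_min (R : realType) (E : set R) (m : R) : Prop :=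
  E m /\ lbound E m.

Definition objective_values (R : realType) (n : nat) (A : 'M[R]_n)
    (S : set 'M[R]_n) (C : set 'rV[R]_('C(n, 2))) : set R :=
  [set frobenius A X | X in S `&` [set X | C (pi_T X)]].

(* Main.v *)
Require Import Defs.
From HB Require Import structures.
From mathcomp Require Import all_boot all_order all_algebra.
From mathcomp Require Import all_classical all_reals all_analysis.
From mathcomp Require Import ring lra.

Set Implicit Arguments.
Unset Strict Implicit.
Unset Printing Implicit Defensive.
Import Order.TTheory GRing.Theory Num.Theory.
Import numFieldNormedType.Exports.
Local Open Scope classical_set_scope.
Local Open Scope ring_scope.

(* Fix the strictly upper triangular part of a contraction X. For each choice of
   signs s, some orthogonal Q of determinant \prod_i s i has the same strictly
   upper triangular part and maximizes every s i * X i i simultaneously over all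
   contractions with that part (signed_max_completion). Let M and m be the
   maximum and minimum over the ball, with M attained at X, and let s be the
   signs of A, so that \prod_i s i = -1. Flipping the i-th sign gives Q_i in
   SO(n) with <A, Q_i> >= \sum_(k != i) A k k * X k k + A i i * Qm i i, where Qm
   is the completion for the signs -s and attains the smallest A i i * Q i i for
   all i at once. Averaging over i gives (1 - 1/n) M + <A, Qm> / n.

   To construct Q for positive signs, first perturb X to a strict contraction.
   Then Q is built by induction on n together with a factorization Q V = W, V
   lower and W upper triangular with positive diagonals; the factorization
   yields both det Q = 1 and the maximality of the diagonal. The general case
   follows from compactness of SO(n). *)

(** * Squared Euclidean norm of column vectors *)

Definition sqnorm (R : numDomainType) n (v : 'cV[R]_n) : R :=
  \sum_i v i 0 ^+ 2.

Lemma sqnormE (R : numDomainType) n (v : 'cV[R]_n) :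
  v^T *m v = (sqnorm v)%:M.
Proof.
rewrite [LHS]mx11_scalar mxE; congr _%:M.
by apply: eq_bigr => i _; rewrite mxE expr2.
Qed.

Lemma sqnorm_orth (R : numDomainType) n (Q : 'M[R]_n) (v : 'cV_n) :
  Q^T *m Q = 1%:M -> sqnorm (Q *m v) = sqnorm v.
Proof.
move=> QQ; have := sqnormE (Q *m v).
rewrite trmx_mul -mulmxA (mulmxA Q^T) QQ mul1mx sqnormE => /matrixP/(_ 0 0).
by rewrite !mxE eqxx !mulr1n.
Qed.

Lemma sqnormZ (R : numDomainType) n c (v : 'cV[R]_n) :
  sqnorm (c *: v) = c ^+ 2 * sqnorm v.
Proof.
by rewrite /sqnorm mulr_sumr; apply: eq_bigr => i _; rewrite mxE exprMn.
Qed.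

Lemma sqnorm_col_mx (R : numDomainType) m n (u : 'cV[R]_m) (v : 'cV_n) :
  sqnorm (col_mx u v) = sqnorm u + sqnorm v.
Proof.
by rewrite /sqnorm big_split_ord /=; congr (_ + _); apply: eq_bigr => i _;
  rewrite ?col_mxEu ?col_mxEd.
Qed.

Lemma sqnorm_ge0 (R : realDomainType) n (v : 'cV[R]_n) : 0 <= sqnorm v.
Proof. by apply: sumr_ge0 => i _; rewrite sqr_ge0. Qed.

Lemma sqnorm_gt0 (R : realDomainType) n (v : 'cV[R]_n) :
  v != 0 -> 0 < sqnorm v.
Proof.
move=> v0; rewrite lt_neqAle sqnorm_ge0 andbT eq_sym.
apply: contra v0; rewrite psumr_eq0 => [/allP h|i _]; last exact: sqr_ge0.
apply/eqP/colP => i; rewrite mxE; apply/eqP.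
by have := h i (mem_index_enum _); rewrite sqrf_eq0.
Qed.

(** * Positive definite matrices and Cholesky factorization *)

Definition posdef (R : numDomainType) n (S : 'M[R]_n) :=
  forall v : 'cV_n, v != 0 -> 0 < (v^T *m S *m v) 0 0.

Definition pos_lower (R : numDomainType) n (L : 'M[R]_n) :=
  is_trig_mx L /\ forall i, 0 < L i i.

Lemma pos_lower_block (R : numDomainType) n c (b : 'cV[R]_n) L :
  0 < c -> pos_lower L ->
  pos_lower (block_mx (c%:M : 'M[R]_1) 0 b L : 'M[R]_(1 + n)).
Proof.
move=> c0 [tL pL]; split.
  by rewrite is_trig_block_mx // eqxx tL mx11_is_trig.
move=> i; rewrite -(splitK i); case: (fintype.split i) => j /=.
  by rewrite block_mxEul ord1 mxE eqxx mulr1n.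
by rewrite block_mxEdr.
Qed.

Lemma pos_lower_mul (R : numDomainType) n (A B : 'M[R]_n) :
  pos_lower A -> pos_lower B -> pos_lower (A *m B).
Proof.
move=> [/is_trig_mxP tA pA] [/is_trig_mxP tB pB]; split.
  apply/is_trig_mxP => i j ij; rewrite mxE big1 // => k _.
  have [ik|ki] := ltnP i k; first by rewrite tA // mul0r.
  by rewrite tB ?mulr0 // (leq_ltn_trans ki).
move=> i; rewrite mxE (bigD1 i) //= big1 ?addr0 ?mulr_gt0 // => k.
rewrite neq_ltn => /orP[ki|ik]; first by rewrite tB ?mulr0.
by rewrite tA ?mul0r.
Qed.

Lemma det_pos_lower (R : numDomainType) n (L : 'M[R]_n) :
  pos_lower L -> 0 < \det L.
Proof. by move=> [tL pL]; rewrite det_trig // prodr_gt0. Qed.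

(** Induction on the size: the lower right block is factored first, and what remains of the corner
    entry is its Schur complement. The inverse [L'] is carried along because its triangular shape
    and positive diagonal are used in [orth_factor]. *)
Lemma cholesky (R : rcfType) n (S : 'M[R]_n) :
  S^T = S -> posdef S ->
  exists L L', [/\ pos_lower L, pos_lower L', L *m L' = 1%:M &
                   L^T *m L = S].
Proof.
elim: n S => [|n IH] S symS pdS.
  exists 0, 0; split; try (by split; [apply/is_trig_mxP|]; case);
  by apply/matrixP; case.
rewrite -[n.+1]/(1 + n)%N in S symS pdS *.
pose a := ulsubmx S; pose r := dlsubmx S; pose S2 := drsubmx S.
have ES : S = block_mx a r^T r S2.
  rewrite -[LHS]submxK /r; congr (block_mx _ _ _ _).
  by rewrite -{1}symS trmx_dlsub.
have symS2 : S2^T = S2 by rewrite /S2 trmx_drsub symS.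
have [] := IH S2 => //.
  move=> v v0.
  have v0' : col_mx (0 : 'cV_1) v != 0.
    by apply: contra v0 => /eqP; rewrite -col_mx0 => /eq_col_mx[_ ->].
  have := pdS _ v0'; rewrite ES tr_col_mx mul_row_block mul_row_col.
  by rewrite !trmx0 !mul0mx !add0r mulmx0 add0r.
move=> L2 [L2' [pL pL' LL' LLS]].
have L'L : L2' *m L2 = 1%:M by exact: mulmx1C.
pose b := L2'^T *m r.
have Lb : L2^T *m b = r by rewrite /b mulmxA -trmx_mul L'L trmx1 mul1mx.
(* [d] is the Schur complement a - r^T S2^-1 r. It is the value of the form of [S] at (1, -S2^-1 r),
   hence positive. *)
pose d := a 0 0 - sqnorm b.
have d0 : 0 < d.
  pose y := - (L2' *m b).
  have v0' : col_mx (1%:M : 'cV_1) y != 0.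
    apply/eqP; rewrite -col_mx0 => /eq_col_mx[/matrixP/(_ 0 0)].
    by rewrite !mxE => /eqP; rewrite oner_eq0.
  have Ly : L2 *m y = - b by rewrite /y mulmxN mulmxA LL' mul1mx.
  have := pdS _ v0'; rewrite ES tr_col_mx mul_row_block mul_row_col.
  have yr : y^T *m r = - (sqnorm b)%:M.
    by rewrite -Lb mulmxA -trmx_mul Ly linearN /= mulNmx sqnormE.
  have ry : r^T *m y = - (sqnorm b)%:M.
    by rewrite -[LHS]trmxK trmx_mul trmxK yr linearN /= tr_scalar_mx.
  have ySy : y^T *m S2 *m y = (sqnorm b)%:M.
    by rewrite -LLS mulmxA -trmx_mul -mulmxA Ly mulmxN -mulNmx -linearN /= opprK
      sqnormE.
  rewrite trmx1 !mul1mx mulmx1 mulmxDl yr ry ySy !mxE eqxx !mulr1n.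
  by rewrite addNr addr0 /d /a !mxE.
set c := Num.sqrt d; have c0 : 0 < c by rewrite sqrtr_gt0.
exists (block_mx (c%:M : 'M[R]_1) 0 b L2).
exists (block_mx (c^-1%:M : 'M[R]_1) 0 (- (L2' *m b *m (c^-1)%:M)) L2').
split.
- exact: pos_lower_block.
- by apply: pos_lower_block => //; rewrite invr_gt0.
- rewrite mulmx_block !mulmx0 !mul0mx !add0r !addr0 -scalar_mxM.
  rewrite divff ?lt0r_neq0 // mulmxN !mulmxA LL' mul1mx subrr.
  by rewrite -scalar_mx_block.
rewrite tr_block_mx mulmx_block trmx0 !mul0mx !add0r Lb LLS.
have -> : b^T *m L2 = r^T by rewrite -Lb (trmx_mul L2^T) trmxK.
rewrite mulmx0 add0r tr_scalar_mx -scalar_mxM.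
rewrite sqnormE -raddfD /= -expr2 sqr_sqrtr ?ltW // subrK -mx11_scalar.
by rewrite -ES.
Qed.

(** * Orthogonal completion of a strictly upper triangular part *)

(* For each i, the block of T with rows up to i and columns after i has norm
   less than 1. *)
Definition strict_blocks (R : numDomainType) n (T : 'M[R]_n) :=
  forall (i : 'I_n) (v : 'cV_n), v != 0 ->
    (forall l : 'I_n, (l <= i)%N -> v l 0 = 0) ->
    \sum_(k < n | (k <= i)%N) (T *m v) k 0 ^+ 2 < sqnorm v.

(* Let t be the first row of T right of the diagonal, L a Cholesky factor of
   1 - t^T t and q = sqrt (1 - t t^T). The matrix K = [q t; g L] with
   g = - L t^T / q is orthogonal, and Q = diag(1, Q') K, where Q' completes
   T2 L^-1 for the lower right block T2 of T; as L is lower triangular, right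
   multiplication by L respects strictly upper triangular parts. *)
Lemma orth_factor (R : rcfType) n (T : 'M[R]_n) :
  strict_blocks T ->
  exists Q V W, [/\ Q^T *m Q = 1%:M, Q *m V = W, pos_lower V,
    pos_lower W^T & forall i j : 'I_n, (i < j)%N -> Q i j = T i j].
Proof.
elim: n T => [|n IH] T hT.
  exists 1%:M, 0, 0; split; try (by split; [apply/is_trig_mxP|]; case);
    try (by apply/matrixP; case); by case.
rewrite -[n.+1]/(1 + n)%N in T hT *.
pose t := ursubmx T : 'rV_n; pose T2 := drsubmx T.
have ET v : T *m col_mx 0 v = col_mx (t *m v) (T2 *m v).
  by rewrite -{1}[T]submxK mul_block_col !mulmx0 !add0r.
have tE (v : 'cV_n) : v^T *m (1%:M - t^T *m t) *m v
    = (sqnorm v - (t *m v) 0 0 ^+ 2)%:M.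
  rewrite mulmxBr mulmx1 mulmxBl sqnormE.
  have -> : v^T *m (t^T *m t) *m v = (t *m v)^T *m (t *m v).
    by rewrite trmx_mul !mulmxA.
  by rewrite {1 2}[t *m v]mx11_scalar tr_scalar_mx -scalar_mxM -raddfB expr2.
have [] := @cholesky R n (1%:M - t^T *m t).
- by rewrite linearB /= trmx1 trmx_mul trmxK.
- move=> v v0.
  have v0' : col_mx (0 : 'cV_1) v != 0.
    by apply: contra v0 => /eqP; rewrite -col_mx0 => /eq_col_mx[_ ->].
  have := hT (lshift n 0) _ v0' _; rewrite ET sqnorm_col_mx.
  have -> : sqnorm (0 : 'cV[R]_1) = 0 by rewrite /sqnorm big_ord1 mxE expr0n.
  rewrite big_split_ord /= add0r [X in _ + X]big1 ?addr0; last by [].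
  rewrite big_mkcond /= big_ord1 /= col_mxEu tE.
  rewrite [X in _ -> 0 < X]mxE eqxx mulr1n subr_gt0; apply=> l.
  rewrite -(splitK l); case: (fintype.split l) => j //= _.
  by rewrite col_mxEu mxE.
move=> L [L' [pL pL' LL' LLS]].
have L'L : L' *m L = 1%:M by exact: mulmx1C.
have Lnorm v : sqnorm (L *m v) = sqnorm v - (t *m v) 0 0 ^+ 2.
  have := sqnormE (L *m v).
  rewrite trmx_mul -mulmxA (mulmxA L^T) LLS mulmxA tE => /matrixP/(_ 0 0).
  by rewrite [LHS]mxE [RHS]mxE eqxx !mulr1n => <-.
pose T' := T2 *m L'.
(* Strictness of [T'] comes from [hT] at (0, L' v): the first row contributes (t L' v)^2, and by
   [Lnorm] subtracting it from |L' v|^2 leaves |v|^2. As [L'] is lower triangular, it keeps the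
   leading zeros of v. *)
have [] := IH T'.
  move=> i v v0 vi.
  have v0' : L' *m v != 0.
    apply: contra v0 => /eqP e; apply/eqP.
    by rewrite -[v]mul1mx -LL' -mulmxA e mulmx0.
  have v0'' : col_mx (0 : 'cV_1) (L' *m v) != 0.
    by apply: contra v0' => /eqP; rewrite -col_mx0 => /eq_col_mx[_ ->].
  have := hT (rshift 1 i) _ v0'' _; rewrite ET sqnorm_col_mx.
  have -> : sqnorm (0 : 'cV[R]_1) = 0 by rewrite /sqnorm big_ord1 mxE expr0n.
  rewrite big_split_ord /= add0r big_mkcond /= big_ord1 /= col_mxEu.
  rewrite -ltrBrDl -Lnorm mulmxA LL' mul1mx.
  under eq_bigr do rewrite col_mxEd mulmxA.
  apply=> l; rewrite -(splitK l); case: (fintype.split l) => j /= jl.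
    by rewrite col_mxEu mxE.
  rewrite col_mxEd mxE big1 // => k _.
  have [ki|ik] := leqP k i; first by rewrite vi ?mulr0.
  have /is_trig_mxP -> // := pL'.1; rewrite ?mul0r //.
  by rewrite (leq_ltn_trans _ ik) // -(leq_add2l 1).
move=> Q' [V' [W' [QQ QV pV pW hQ]]].
pose d := 1 - sqnorm t^T.
have tt : t *m t^T = (1 - d)%:M.
  by rewrite /d opprB addrC subrK -sqnormE trmxK.
(* For t nonzero, |L t^T|^2 = |t|^2 - |t|^4 = (1 - d) d is positive, and so is 1 - d = |t|^2. *)
have d0 : 0 < d.
  have [t0|t0] := eqVneq t^T 0.
    rewrite /d t0 /sqnorm big1 ?subr0 ?ltr01 // => i _.
    by rewrite mxE expr0n.
  have Lt0 : L *m t^T != 0.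
    apply: contra t0 => /eqP e; apply/eqP.
    by rewrite -[t^T]mul1mx -L'L -mulmxA e mulmx0.
  have := sqnorm_gt0 Lt0; rewrite Lnorm tt mxE eqxx mulr1n.
  have -> : sqnorm t^T = 1 - d by rewrite /d; ring.
  have -> : 1 - d - (1 - d) ^+ 2 = (1 - d) * d by ring.
  rewrite pmulr_rgt0 // /d opprB addrC subrK.
  exact: sqnorm_gt0.
pose q := Num.sqrt d; have q0 : 0 < q by rewrite sqrtr_gt0.
have qq : q * q = d by rewrite -expr2 sqr_sqrtr ?ltW.
have qV : q * q^-1 = 1 by rewrite divff ?lt0r_neq0.
pose g := - (q^-1 *: (L *m t^T)).
have gL : L^T *m g = - (q *: t^T).
  rewrite /g mulmxN -scalemxAr mulmxA LLS mulmxBl mul1mx -mulmxA tt.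
  rewrite mul_mx_scalar -{1}[t^T]scale1r -scalerBl opprB addrC subrK scalerA.
  by rewrite -qq mulrA mulVf ?lt0r_neq0 // mul1r.
have gg : g^T *m g = (1 - d)%:M.
  have -> : g^T = - (q^-1 *: (t *m L^T)).
    by rewrite /g linearN /= linearZ /= trmx_mul trmxK.
  rewrite mulNmx -scalemxAl.
  rewrite -mulmxA gL mulmxN scalerN opprK -scalemxAr scalerA mulVf ?lt0r_neq0 //.
  by rewrite scale1r.
pose K : 'M[R]_(1 + n) := block_mx q%:M t g L.
have KK : K^T *m K = 1%:M.
  rewrite /K tr_block_mx mulmx_block LLS gL gg tr_scalar_mx -scalar_mxM qq.
  have -> : g^T *m L = - (q *: t).
    by rewrite -[LHS]trmxK trmx_mul trmxK gL linearN /= linearZ /= trmxK.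
  rewrite mul_scalar_mx mul_mx_scalar !subrr (addrC (t^T *m t)) subrK.
  by rewrite -raddfD /= addrC subrK -scalar_mx_block.
pose D : 'M[R]_(1 + n) := block_mx 1%:M 0 0 Q'.
have DD : D^T *m D = 1%:M.
  rewrite /D tr_block_mx mulmx_block !trmx0 trmx1 !mulmx0 !mul0mx !mul1mx QQ.
  by rewrite !addr0 add0r -scalar_mx_block.
have DK : D *m K = block_mx q%:M t (Q' *m g) (Q' *m L).
  by rewrite /D /K mulmx_block !mul0mx !mul1mx !addr0 !add0r.
(* The first column (q, t^T) of V is the transposed first row of the orthogonal [K], so [K] and then
   [D] send it to the first unit vector. The other columns (0, L' V') go to (t L' V', V') under [K],
   then to (t L' V', W') under [D]. *)
exists (D *m K), (block_mx q%:M 0 t^T (L' *m V')).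
exists (block_mx 1%:M (t *m (L' *m V')) 0 W'); split.
- by rewrite trmx_mul -mulmxA (mulmxA D^T) DD mul1mx KK.
- rewrite DK mulmx_block !mulmx0 !add0r -QV.
  rewrite -scalar_mxM qq tt -raddfD /= addrC subrK.
  rewrite (_ : Q' *m g *m q%:M + _ = 0); last first.
    rewrite /g mul_mx_scalar mulmxN -scalemxAr.
    by rewrite scalerN scalerA qV scale1r mulmxA addNr.
  by rewrite !mulmxA -(mulmxA Q' L L') LL' mulmx1.
- by apply: pos_lower_block => //; apply: pos_lower_mul.
- by rewrite tr_block_mx trmx0 trmx1; apply: pos_lower_block.
move=> i j; rewrite DK -[in T i j](submxK T).
rewrite -(splitK i) -(splitK j).
case: (fintype.split i) => i' /=; case: (fintype.split j) => j' /=.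
- by rewrite !ord1.
- by rewrite !block_mxEur.
- by move=> ij; have := ltn_ord j'; rewrite ltnS leqn0 => /eqP j0; rewrite j0 in ij.
rewrite !block_mxEdr ltn_add2l => ij.
have -> : drsubmx T = T' *m L by rewrite /T' -mulmxA L'L mulmx1.
rewrite !mxE; apply: eq_bigr => k _.
have [jk|kj] := leqP j' k; first by rewrite hQ // (leq_trans ij).
by have /is_trig_mxP -> := pL.1; rewrite ?mulr0.
Qed.

(** * Contractions and maximality of the diagonal *)

Definition contraction (R : numDomainType) n (X : 'M[R]_n) :=
  forall v, sqnorm (X *m v) <= sqnorm v.

Lemma contraction_strict_blocks (R : realDomainType) n (X : 'M[R]_n) c :
  contraction X -> 0 <= c < 1 -> strict_blocks (c *: X).
Proof.
move=> hX /andP[c0 c1] i v v0 _.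
apply: (@le_lt_trans _ _ (sqnorm (c *: X *m v))).
  rewrite /sqnorm big_mkcond /=; apply: ler_sum => k _.
  by case: ifP => // _; exact: sqr_ge0.
rewrite -scalemxAl sqnormZ; apply: (@le_lt_trans _ _ (c ^+ 2 * sqnorm v)).
  by rewrite ler_wpM2l ?sqr_ge0.
by rewrite gtr_pMl ?sqnorm_gt0 // expr_lt1.
Qed.

Lemma contractionM_orth (R : realDomainType) n (X D : 'M[R]_n) :
  contraction X -> D^T *m D = 1%:M -> contraction (X *m D).
Proof. by move=> hX DD v; rewrite -mulmxA -(sqnorm_orth v DD) hX. Qed.

Lemma contraction_orth (R : numDomainType) n (Q : 'M[R]_n) :
  Q^T *m Q = 1%:M -> contraction Q.
Proof. by move=> QQ v; rewrite sqnorm_orth. Qed.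

Lemma contraction_coord (R : realDomainType) n (X : 'M[R]_n) i j :
  contraction X -> `|X i j| <= 1.
Proof.
move=> /(_ (delta_mx j 0)); rewrite -colE [leRHS](bigD1 j) //=.
rewrite big1 => [|k /negPf kj].
  rewrite mxE !eqxx expr1n addr0 /sqnorm (bigD1 i) //= !mxE => h.
  rewrite -(@expr_le1 _ 2) // real_normK ?num_real //.
  by apply: le_trans h; rewrite lerDl sumr_ge0 // => k _; rewrite sqr_ge0.
by rewrite mxE kj expr0n.
Qed.

(* With v and w the i-th columns of V and W = Q V, the vector v vanishes before
   i and w after i, so w^T X v - w^T Q v only involves X i i - Q i i; and
   w^T Q v = |v| |w| is the maximum of w^T X v over contractions X. *)
Lemma orth_factor_max (R : realDomainType) n (Q V W X : 'M[R]_n) :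
  Q^T *m Q = 1%:M -> Q *m V = W -> pos_lower V -> pos_lower W^T ->
  contraction X -> (forall i j : 'I_n, (i < j)%N -> X i j = Q i j) ->
  forall i, X i i <= Q i i.
Proof.
move=> QQ QV [/is_trig_mxP tV pV] [/is_trig_mxP tW pW] hX XQ i.
pose v := col i V; pose w := col i W.
have Ew : Q *m v = w by rewrite /v /w !colE mulmxA QV.
have vw : sqnorm w = sqnorm v by rewrite -Ew sqnorm_orth.
have vE k : v k 0 = V k i by rewrite mxE.
have wE k : w k 0 = W k i by rewrite mxE.
have XQv k : ((X - Q) *m v) k 0 = \sum_l (X k l - Q k l) * V l i.
  by rewrite mxE; apply: eq_bigr => l _; rewrite !mxE.
have wiX : \sum_k w k 0 * ((X - Q) *m v) k 0 = W i i * V i i * (X i i - Q i i).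
  rewrite (bigD1 i) //= big1 ?addr0 => [|k ki].
    rewrite XQv (bigD1 i) //= big1 ?addr0 => [|l]; first by rewrite wE; ring.
    rewrite neq_ltn => /orP[li|il]; first by rewrite tV ?mulr0.
    by rewrite XQ // subrr mul0r.
  move: ki; rewrite neq_ltn => /orP[ki|ik]; last first.
    by have := tW _ _ ik; rewrite mxE wE => ->; rewrite mul0r.
  rewrite XQv big1 ?mulr0 // => l _.
  have [li|il] := ltnP l i; first by rewrite tV ?mulr0.
  by rewrite XQ ?subrr ?mul0r // (leq_trans ki).
have wv0 : 0 < W i i * V i i.
  by rewrite mulr_gt0 //; have := pW i; rewrite mxE.
rewrite -subr_le0 -(pmulr_rle0 _ wv0) -wiX mulmxBl Ew.
(* Termwise 2 y (x - y) = x^2 - y^2 - (x - y)^2, so twice the sum is at most |X v|^2 - |w|^2, and |X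
   v| <= |v| = |w|. *)
rewrite -(@pmulr_rle0 _ 2) // mulr_sumr.
apply: (@le_trans _ _ (sqnorm (X *m v) - sqnorm w)); last first.
  by rewrite subr_le0 vw hX.
rewrite /sqnorm -sumrB; apply: ler_sum => k _.
rewrite [(_ - w) k 0]mxE [(- w) k 0]mxE.
move: (w k 0) ((X *m v) k 0) => y x.
by rewrite -subr_ge0 [leRHS](_ : _ = (x - y) ^+ 2) ?sqr_ge0 //; ring.
Qed.

Lemma orth_det1 (R : realDomainType) n (Q : 'M[R]_n) :
  Q^T *m Q = 1%:M -> 0 < \det Q -> \det Q = 1.
Proof.
move=> QQ d0; have := congr1 determinant QQ.
rewrite det_mulmx det_tr det1 -expr2 => /eqP.
by rewrite sqrf_eq1 => /orP[/eqP //|/eqP d1]; rewrite d1 oppr_gt0 ltr10 in d0.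
Qed.

(** Scaling by [c] makes the blocks strict. If [X] agrees with [X0] above the diagonal, then c X is
    a contraction that agrees with [Q] there, and [orth_factor_max] compares the diagonals. *)
Lemma strict_max_completion (R : rcfType) n (X0 : 'M[R]_n) c :
  contraction X0 -> 0 <= c < 1 ->
  exists Q, [/\ Q^T *m Q = 1%:M, \det Q = 1,
    forall i j : 'I_n, (i < j)%N -> Q i j = c * X0 i j &
    forall X, contraction X ->
      (forall i j : 'I_n, (i < j)%N -> X i j = X0 i j) ->
      forall i, c * X i i <= Q i i].
Proof.
move=> hX0 hc; have := contraction_strict_blocks hX0 hc.
move=> /orth_factor[Q [V [W [QQ QV pV pW QX0]]]].
exists Q; split=> //.
- apply: orth_det1 => //; rewrite -(pmulr_lgt0 _ (det_pos_lower pV)).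
  by rewrite -det_mulmx QV -det_tr det_pos_lower.
- by move=> i j ij; rewrite QX0 // mxE.
move=> X hX XX0 i.
have := @orth_factor_max _ _ Q V W (c *: X) QQ QV pV pW _ _ i.
rewrite mxE; apply=> [v|k l kl]; last by rewrite QX0 // !mxE XX0.
rewrite -scalemxAl sqnormZ; apply: le_trans (hX v).
have /andP[c0 c1] := hc.
by rewrite ler_piMl ?sqnorm_ge0 // expr_le1 // ltW.
Qed.

(** * Continuity and compactness for matrices *)

Lemma continuous_mx (R : realType) (T : topologicalType) m n
    (f : T -> 'M[R]_(m, n)) :
  (forall i j, continuous (fun x => f x i j)) -> continuous f.
Proof.
move=> cf x A [P hP PA].
suff : nbhs x (fun y => forall i j, P i j (f y i j)).
  by apply: filterS => y Py; apply: PA.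
apply: filter_forall => i; apply: filter_forall => j.
exact: cf (hP i j).
Qed.

Lemma continuous_sumr (R : realType) (T : topologicalType) (I : Type)
    (r : seq I) (P : pred I) (F : I -> T -> R) :
  (forall i, P i -> continuous (F i)) ->
  continuous (fun x => \sum_(i <- r | P i) F i x).
Proof. by apply: continuous_big; exact: add_continuous. Qed.

Lemma continuous_prodr (R : realType) (T : topologicalType) (I : Type)
    (r : seq I) (P : pred I) (F : I -> T -> R) :
  (forall i, P i -> continuous (F i)) ->
  continuous (fun x => \prod_(i <- r | P i) F i x).
Proof. by apply: continuous_big; exact: mul_continuous. Qed.

Lemma continuous_mul_fun (R : realType) (T : topologicalType) (f g : T -> R) :
  continuous f -> continuous g -> continuous (fun x => f x * g x).
Proof. by move=> cf cg x; exact: continuousM (cf x) (cg x). Qed.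

(** A product of segments is compact among row vectors; [vec_mx] carries it over to matrices. *)
Lemma compact_mx_le1 (R : realType) m n :
  compact [set X : 'M[R]_(m, n) | forall i j, `|X i j| <= 1].
Proof.
have c1 : compact [set v : 'rV[R]_(m * n) | forall k, v ord0 k \in `[-1, 1]].
  apply: (@rV_compact R _ (fun=> `[-1, 1]%classic)) => _.
  exact: segment_compact.
have cv : continuous (@vec_mx R m n).
  apply: continuous_mx => i j v.
  rewrite (_ : (fun _ => _) = (fun v : 'rV[R]_(m * n) => v ord0 (mxvec_index i j))).
    exact: coord_continuous.
  by apply/funext => u; rewrite -{2}[u]vec_mxK mxvecE.
have := continuous_compact (continuous_subspaceT cv) c1.
congr compact; apply/seteqP; split => [_ [v hv <-] i j|X hX].
  by rewrite mxE ler_norml; have := hv (mxvec_index i j); rewrite in_itv.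
exists (mxvec X); last exact: mxvecK.
move=> k; case/mxvec_indexP: k => i j.
by rewrite mxvecE in_itv /= -ler_norml.
Qed.

(** A cluster point [x] of [u] works for all [g] at once: if g x > 0, then g (u k) <= g x / 2 for
    large k, while [u] returns infinitely often to the neighbourhood of [x] where g > g x / 2. *)
Lemma compact_limit (R : realType) (T : topologicalType) (K : set T)
    (u : nat -> T) :
  compact K -> (forall k, K (u k)) ->
  exists2 x, K x & forall (g : T -> R) (c : R), continuous g ->
    (forall k, g (u k) <= c / k.+1%:R) -> g x <= 0.
Proof.
move=> cK uK.
have [|x [Kx cx]] := cK (u @ \oo) _; first by exists 0%N => // k _; exact: uK.
exists x => // g c cg gu; rewrite leNgt; apply/negP => gx0.
pose e := g x / 2.
have e0 : 0 < e by rewrite divr_gt0.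
have ex : e < g x by rewrite /e ltr_pdivrMr // ltr_pMr // ltr1n.
have [||y [/= gy]] := cx [set y | g y <= e] [set y | e < g y].
- suff : \forall k \near \oo, g (u k) <= e by [].
  near=> k; apply: (le_trans (gu k)).
  rewrite ler_pdivrMr // mulrC -ler_pdivrMr //.
  near: k; exists (Num.trunc (c / e)).+1 => // k /= hk.
  rewrite (le_trans (ltW (truncnS_gt _))) // ler_nat.
  exact: leq_trans hk _.
- have : nbhs (g x) [set z | e < z].
    exact: open_nbhs_nbhs.
  exact: cg.
by rewrite ltNge gy.
Unshelve. all: by end_near. Qed.

(** * Singular values and the operator norm ball *)

(** With z = M u, p = |z|^2 and q = z^T M z, the form at u - t z is -2 t p + t^2 q, which is
    negative for small t > 0 unless z = 0. *)
Lemma psd_ker (R : realFieldType) n (M : 'M[R]_n) (u : 'cV_n) :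
  M^T = M -> (forall w : 'cV_n, 0 <= (w^T *m M *m w) 0 0) ->
  (u^T *m M *m u) 0 0 = 0 -> M *m u = 0.
Proof.
move=> symM psdM u0; set z := M *m u.
apply/eqP; apply: contraT => z0; have p0 := sqnorm_gt0 z0.
pose q := (z^T *m M *m z) 0 0; have q0 : 0 <= q := psdM z.
pose p := sqnorm z; rewrite -/p in p0.
(* This choice turns the value into -t^2 (q + 2); the added 1 keeps the denominator positive when q
   = 0. *)
pose t := p / (q + 1).
have q1 : 0 < q + 1 by rewrite ltr_wpDl.
have Ez : u^T *m M = z^T by rewrite /z trmx_mul symM.
have zz : (z^T *m z) 0 0 = p by rewrite sqnormE mxE eqxx mulr1n.
have := psdM (u - t *: z).
have -> : (u - t *: z)^T *m M *m (u - t *: z) =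
    u^T *m M *m u - t *: (z^T *m z) - t *: (z^T *m z) + t ^+ 2 *: (z^T *m M *m z).
  have -> : (u - t *: z)^T = u^T - t *: z^T by rewrite linearB /= linearZ.
  rewrite mulmxBl -scalemxAl Ez mulmxBr !mulmxBl -!scalemxAr -!scalemxAl.
  rewrite -(mulmxA z^T M u) -/z scalerA -expr2.
  by rewrite opprB addrA addrAC.
have -> (a b c : 'M[R]_1) : (a - t *: b - t *: b + t ^+ 2 *: c) 0 0 =
    a 0 0 - t * b 0 0 - t * b 0 0 + t ^+ 2 * c 0 0 by rewrite !mxE.
rewrite u0 zz -/q.
rewrite leNgt => /negP[].
have -> : 0 - t * p - t * p + t ^+ 2 * q = - (t * t * (q + 2)).
  have -> : p = t * (q + 1) by rewrite /t divfK ?lt0r_neq0.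
  ring.
have t0 : 0 < t by rewrite divr_gt0.
have q2 : 0 < q + 2 by rewrite ltr_wpDl.
by rewrite oppr_lt0; apply: mulr_gt0 => //; apply: mulr_gt0.
Qed.

Lemma continuous_sqnorm_mull (R : realType) m n (v : 'cV[R]_n) :
  continuous (fun X : 'M[R]_(m, n) => sqnorm (X *m v)).
Proof.
apply: continuous_sumr => i _.
have cE : continuous (fun X : 'M[R]_(m, n) => (X *m v) i 0).
  rewrite (_ : (fun _ => _) = (fun X : 'M[R]_(m, n) =>
    \sum_j X i j * v j 0)); last by apply/funext => X; rewrite mxE.
  apply: continuous_sumr => j _; apply: continuous_mul_fun.
    exact: coord_continuous.
  exact: cst_continuous.
exact: continuous_mul_fun.
Qed.

Lemma continuous_sqnorm_mulr (R : realType) m n (X : 'M[R]_(m, n)) :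
  continuous (fun v : 'cV[R]_n => sqnorm (X *m v)).
Proof.
apply: continuous_sumr => i _.
have cE : continuous (fun v : 'cV[R]_n => (X *m v) i 0).
  rewrite (_ : (fun _ => _) = (fun v : 'cV[R]_n =>
    \sum_j X i j * v j 0)); last by apply/funext => v; rewrite mxE.
  apply: continuous_sumr => j _; apply: continuous_mul_fun.
    exact: cst_continuous.
  exact: coord_continuous.
exact: continuous_mul_fun.
Qed.

Lemma closed_preimage_continuous (R : realType) (T : topologicalType)
    (f : T -> R) (D : set R) :
  continuous f -> closed D -> closed (f @^-1` D).
Proof. by move=> cf cD; apply: preimage_closed => // x _; exact: cf. Qed.

Lemma compact_sphere (R : realType) n :
  compact [set v : 'cV[R]_n | sqnorm v = 1].
Proof.
apply: (@subclosed_compact _ _ _ _ (@compact_mx_le1 R n 1)).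
  have := @continuous_sqnorm_mulr R n n 1%:M.
  move=> /closed_preimage_continuous/(_ (@closed_eq R 1)).
  by congr closed; apply/funext => v; rewrite /preimage /= mul1mx.
move=> v /= v1 i j; rewrite ord1 -(@expr_le1 _ 2) // real_normK ?num_real //.
by rewrite -v1 /sqnorm (bigD1 i) //= lerDl sumr_ge0 // => k _; rewrite sqr_ge0.
Qed.

Lemma sqnorm_mul (R : numDomainType) m n (X : 'M[R]_(m, n)) v :
  (v^T *m (X^T *m X) *m v) 0 0 = sqnorm (X *m v).
Proof.
by rewrite mulmxA -trmx_mul -mulmxA sqnormE mxE eqxx mulr1n.
Qed.

(* The eigenvalue is the maximum of the Rayleigh quotient of X^T X. *)
Lemma max_sqnorm_eigen (R : realType) n (X : 'M[R]_n) (v : 'cV[R]_n) :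
  v != 0 -> exists2 a, eigenvalue (X^T *m X) a &
    0 <= a /\ forall w : 'cV_n, sqnorm (X *m w) <= a * sqnorm w.
Proof.
move=> v0.
have nz (w : 'cV[R]_n) : w != 0 -> sqnorm ((Num.sqrt (sqnorm w))^-1 *: w) = 1.
  move=> /sqnorm_gt0 w0; rewrite sqnormZ exprVn sqr_sqrtr ?ltW //.
  by rewrite mulVf ?lt0r_neq0.
have [|u] := compact_EVT_max _ (@compact_sphere R n)
  (continuous_subspaceT (@continuous_sqnorm_mulr R n n X)).
  by exists ((Num.sqrt (sqnorm v))^-1 *: v); exact: nz.
rewrite inE => u1 umax; pose a := sqnorm (X *m u).
have hw w : sqnorm (X *m w) <= a * sqnorm w.
  have [->|w0] := eqVneq w 0.
    by rewrite mulmx0 /sqnorm !big1 ?mulr0 // => i _; rewrite mxE expr0n.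
  have := umax ((Num.sqrt (sqnorm w))^-1 *: w).
  rewrite inE => /(_ (nz _ w0)).
  rewrite -scalemxAr sqnormZ exprVn sqr_sqrtr ?sqnorm_ge0 //.
  by rewrite ler_pdivrMl ?sqnorm_gt0 // mulrC.
exists a; last by split=> //; exact: sqnorm_ge0.
(* By [hw] the form of [M] is nonnegative, and it vanishes at the maximizer [u]; so [u] lies in the
   kernel of [M], that is, X^T X u = a u. *)
pose M := a%:M - X^T *m X.
have ME w : (w^T *m M *m w) 0 0 = a * sqnorm w - sqnorm (X *m w).
  rewrite /M mulmxBr mulmxBl.
  have -> (b c : 'M[R]_1) : (b - c) 0 0 = b 0 0 - c 0 0 by rewrite !mxE.
  rewrite sqnorm_mul mul_mx_scalar -scalemxAl sqnormE.
  by congr (_ - _); rewrite !mxE eqxx mulr1n.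
have symM : M^T = M.
  by rewrite /M linearB /= tr_scalar_mx trmx_mul trmxK.
have Mu : M *m u = 0.
  apply: psd_ker => // [w|]; rewrite ME ?subr_ge0 //.
  by rewrite u1 mulr1 subrr.
(* Eigenvectors are row vectors here, hence the transpose. *)
apply/eigenvalueP; exists u^T.
  apply/eqP; rewrite -subr_eq0 -mul_mx_scalar -mulmxBr -opprB -/M mulmxN oppr_eq0.
  by rewrite -symM -trmx_mul Mu trmx0.
apply/eqP => /(congr1 trmx); rewrite trmxK trmx0 => u0.
have := oner_neq0 R; rewrite -u1 u0 /sqnorm big1 ?eqxx // => i _.
by rewrite mxE expr0n.
Qed.

(** The square of a singular value is at most any [c] with |X w|^2 <= c |w|^2 for all w, and the
    largest Rayleigh quotient of X^T X is itself such a square. *)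
Lemma op_ballP (R : realType) n (X : 'M[R]_n) :
  op_ball R n X <-> contraction X.
Proof.
have sing s c : (forall w, sqnorm (X *m w) <= c * sqnorm w) ->
    singular_values X s -> s ^+ 2 <= c.
  move=> hc [s0 /eigenvalueP[y yE y0]].
  have y0' : y^T != 0 by rewrite trmx_eq0.
  have := hc y^T; rewrite -sqnorm_mul trmxK yE -scalemxAl.
  have -> : y *m y^T = (sqnorm y^T)%:M by rewrite -sqnormE trmxK.
  rewrite !mxE eqxx mulr1n.
  by rewrite ler_pM2r ?sqnorm_gt0.
split=> [hX v|hX].
  have [->|v0] := eqVneq v 0.
    by rewrite mulmx0 /sqnorm !big1 // => i _; rewrite mxE expr0n.
  have [a aE [a0 ha]] := max_sqnorm_eigen X v0.
  have aS : singular_values X (Num.sqrt a).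
    by split; [exact: sqrtr_ge0|rewrite sqr_sqrtr].
  apply: (le_trans (ha v)); rewrite ler_piMl ?sqnorm_ge0 //.
  rewrite -(sqr_sqrtr a0) expr_le1 ?sqrtr_ge0 //.
  apply: le_trans hX; apply: ub_le_sup => //.
  exists (Num.sqrt a) => s sS.
  rewrite -(@ler_pXn2r _ 2) ?nnegrE ?sqrtr_ge0 //; last by case: sS.
  by rewrite sqr_sqrtr //; exact: sing sS.
rewrite /op_ball /= /op_norm.
(* An empty set of singular values has supremum 0 by convention. *)
have [->|/set0P S0] := eqVneq (singular_values X) set0; first by rewrite sup0.
apply: ge_sup => // s sS; have [s0 _] := sS.
rewrite -(@expr_le1 _ 2) //; apply: sing sS => w.
by rewrite mul1r hX.
Qed.

(** * Compactness of the ball and of SO(n) *)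

Lemma closed_contraction (R : realType) n :
  closed [set X : 'M[R]_n | contraction X].
Proof.
rewrite (_ : mkset _ = \bigcap_(v in setT)
  ((fun X : 'M[R]_n => sqnorm (X *m v)) @^-1` [set x | x <= sqnorm v])).
  apply: closed_bigI => v _.
  apply: closed_preimage_continuous; first exact: continuous_sqnorm_mull.
  exact: closed_le.
by apply/seteqP; split => X h v => [_|]; exact: h.
Qed.

Lemma compact_op_ball (R : realType) n : compact (op_ball R n).
Proof.
apply: (@subclosed_compact _ _ _ _ (@compact_mx_le1 R n n)).
  rewrite (_ : op_ball R n = [set X | contraction X]).
    exact: closed_contraction.
  by apply/seteqP; split => X /op_ballP.
by move=> X /op_ballP hX i j; exact: contraction_coord.
Qed.

Lemma SO_op_ball (R : realType) n : SO R n `<=` op_ball R n.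
Proof. by move=> X [XX _]; apply/op_ballP/contraction_orth. Qed.

Lemma continuous_det (R : realType) n : continuous (fun X : 'M[R]_n => \det X).
Proof.
apply: continuous_sumr => s _; apply: continuous_mul_fun.
  exact: cst_continuous.
by apply: continuous_prodr => i _; exact: coord_continuous.
Qed.

Lemma closed_SO (R : realType) n : closed (SO R n).
Proof.
rewrite (_ : SO R n = (\bigcap_(p in setT)
  ((fun X : 'M[R]_n => (X^T *m X) p.1 p.2) @^-1`
     [set x | x = (1%:M : 'M[R]_n) p.1 p.2])) `&`
  ((fun X : 'M[R]_n => \det X) @^-1` [set x | x = 1])).
  apply: closedI.
    apply: closed_bigI => -[i j] _.
    apply: closed_preimage_continuous; last exact: closed_eq.
    rewrite (_ : (fun _ => _) = (fun X : 'M[R]_n => \sum_k X k i * X k j)).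
      apply: continuous_sumr => k _.
      by apply: continuous_mul_fun; exact: coord_continuous.
    by apply/funext => X; rewrite mxE; apply: eq_bigr => k _; rewrite mxE.
  apply: closed_preimage_continuous; last exact: closed_eq.
  exact: continuous_det.
apply/seteqP; split => X [XX dX]; split => //.
  by move=> p _; rewrite /preimage /= XX.
by apply/matrixP => i j; exact: (XX (i, j)).
Qed.

Lemma compact_SO (R : realType) n : compact (SO R n).
Proof.
apply: subclosed_compact (@compact_op_ball R n) _; first exact: closed_SO.
exact: SO_op_ball.
Qed.

(** * Maximal completions of arbitrary contractions *)

Lemma continuous_sub_fun (R : realType) (T : topologicalType) (f g : T -> R) :
  continuous f -> continuous g -> continuous (fun x => f x - g x).
Proof. by move=> cf cg x; exact: continuousB (cf x) (cg x). Qed.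

(** The completions of (1 - 1/(k+1)) X0 from [strict_max_completion] lie in the compact SO(n), and
    [Q] is a limit point of them. Each remaining conclusion comes from bounds g (u k) <= const /
    (k+1) with g continuous, equalities being split into two inequalities. *)
Lemma max_completion (R : realType) n (X0 : 'M[R]_n) :
  contraction X0 ->
  exists Q, [/\ Q^T *m Q = 1%:M, \det Q = 1,
    forall i j : 'I_n, (i < j)%N -> Q i j = X0 i j &
    forall X, contraction X ->
      (forall i j : 'I_n, (i < j)%N -> X i j = X0 i j) ->
      forall i, X i i <= Q i i].
Proof.
move=> hX0.
have hc k : 0 <= (1 - k.+1%:R^-1 : R) < 1.
  rewrite subr_ge0 invf_le1 // ?ltr0n // ler1n /= ltrBlDr ltrDl.
  by rewrite invr_gt0 ltr0n.
have /choice[u hu] := fun k => strict_max_completion hX0 (hc k).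
have [k|Q [QQ dQ] hQ] := @compact_limit R _ _ u (@compact_SO R n).
  by have [] := hu k.
have subE (k : nat) (x : R) : x - (1 - k.+1%:R^-1) * x = x / k.+1%:R.
  by ring.
exists Q; split => //.
- move=> i j ij; apply/eqP; rewrite eq_le -subr_le0 -[X in _ && X]subr_le0.
  apply/andP; split.
    apply: (hQ (fun Q => Q i j - X0 i j) (- X0 i j)).
      apply: continuous_sub_fun; first exact: coord_continuous.
      exact: cst_continuous.
    move=> k; have [_ _ h _] := hu k.
    by rewrite h // mulNr -subE opprB.
  apply: (hQ (fun Q => X0 i j - Q i j) (X0 i j)).
    apply: continuous_sub_fun; last exact: coord_continuous.
    exact: cst_continuous.
  by move=> k; have [_ _ h _] := hu k; rewrite h // subE.
move=> X hX XX0 i; rewrite -subr_le0.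
apply: (hQ (fun Q => X i i - Q i i) (X i i)).
  apply: continuous_sub_fun; last exact: coord_continuous.
  exact: cst_continuous.
move=> k; have [_ _ _ h] := hu k.
by rewrite -subE lerB // h.
Qed.

(** Right multiplication by D = diag(s) preserves contractions and agreement above the diagonal, and
    multiplies the i-th diagonal entry by s i. So Q D works when [Q] is a maximal completion of X0
    D. *)
Lemma signed_max_completion (R : realType) n (X0 : 'M[R]_n) (s : 'I_n -> R) :
  contraction X0 -> (forall i, s i ^+ 2 = 1) ->
  exists Q, [/\ Q^T *m Q = 1%:M, \det Q = \prod_i s i,
    forall i j : 'I_n, (i < j)%N -> Q i j = X0 i j &
    forall X, contraction X ->
      (forall i j : 'I_n, (i < j)%N -> X i j = X0 i j) ->
      forall i, s i * X i i <= s i * Q i i].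
Proof.
move=> hX0 s1; pose D := diag_mx (\row_i s i).
have DD : D^T *m D = 1%:M.
  rewrite tr_diag_mx; apply/matrixP => i j.
  by rewrite mul_diag_mx !mxE; case: eqVneq => [->|]; rewrite ?mulr0 // -expr2 s1.
have XD (X : 'M[R]_n) i j : (X *m D) i j = X i j * s j.
  by rewrite mul_mx_diag !mxE.
have [Q [QQ dQ QX0 Qmax]] := max_completion (contractionM_orth hX0 DD).
exists (Q *m D); split.
- by rewrite trmx_mul -mulmxA (mulmxA Q^T) QQ mul1mx.
- by rewrite det_mulmx dQ mul1r det_diag; apply: eq_bigr => i _; rewrite mxE.
- by move=> i j ij; rewrite XD QX0 // XD -mulrA -expr2 s1 mulr1.
move=> X hX XX0 i; rewrite XD [X in _ <= X]mulrC -mulrA -expr2 s1 mulr1.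
rewrite mulrC -XD; apply: Qmax; first exact: contractionM_orth.
by move=> k l kl; rewrite !XD XX0.
Qed.

(** * The projection [pi_T] and the objective *)

Lemma pi_T_eqP (R : realType) n (X Y : 'M[R]_n) :
  pi_T X = pi_T Y <-> forall i j : 'I_n, (i < j)%N -> X i j = Y i j.
Proof.
split=> [XY i j ij|XY].
  have ijP : (i, j) \in upper_pairs n by rewrite inE.
  pose k := cast_ord (card_upper_pairs n) (enum_rank_in ijP (i, j)).
  have := congr1 (fun v : 'rV[R]_('C(n, 2)) => v 0 k) XY.
  by rewrite !mxE /upper_pair /k cast_ordK enum_rankK_in.
apply/rowP => k; rewrite !mxE; apply: XY.
by have := enum_valP (cast_ord (esym (card_upper_pairs n)) k); rewrite inE.
Qed.

Lemma continuous_pi_T (R : realType) n : continuous (@pi_T R n).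
Proof.
apply: continuous_mx => i k.
rewrite (_ : (fun _ => _) =
  (fun X : 'M[R]_n => X (upper_pair k).1 (upper_pair k).2)).
  exact: coord_continuous.
by apply/funext => X; rewrite mxE.
Qed.

Lemma frobeniusE (R : realType) n (A X : 'M[R]_n) :
  frobenius A X = \sum_i \sum_j A j i * X j i.
Proof.
apply: eq_bigr => i _; rewrite mxE.
by apply: eq_bigr => j _; rewrite mxE.
Qed.

Lemma continuous_frobenius (R : realType) n (A : 'M[R]_n) :
  continuous (frobenius A).
Proof.
rewrite (_ : frobenius A = fun X => \sum_i \sum_j A j i * X j i); last first.
  by apply/funext => X; exact: frobeniusE.
apply: continuous_sumr => i _; apply: continuous_sumr => j _.
by apply: continuous_mul_fun; [exact: cst_continuous|exact: coord_continuous].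
Qed.

Lemma objective_max (R : realType) n (A : 'M[R]_n) K C X :
  compact K -> closed C -> K X -> C (pi_T X) ->
  exists m, is_max (objective_values A K C) m.
Proof.
move=> cK cC KX CX.
have cKC : compact (K `&` [set Y : 'M[R]_n | C (pi_T Y)]).
  apply: compact_closedI => //.
  by apply: preimage_closed => // Y _; exact: continuous_pi_T.
have [|Y] := compact_EVT_max _ cKC
  (continuous_subspaceT (@continuous_frobenius R n A)).
  by exists X.
rewrite inE => YKC Ymax; exists (frobenius A Y); split; first by exists Y.
by move=> _ [Z ZKC <-]; apply: Ymax; rewrite inE.
Qed.

Lemma objective_min (R : realType) n (A : 'M[R]_n) K C X :
  compact K -> closed C -> K X -> C (pi_T X) ->
  exists m, is_min (objective_values A K C) m.
Proof.
move=> cK cC KX CX; have [m [[Y YKC Ym] mub]] := objective_max (- A) cK cC KX CX.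
have NE Z : frobenius (- A) Z = - frobenius A Z.
  by rewrite /frobenius linearN /= mulNmx linearN.
exists (- m); split; first by exists Y => //; rewrite -Ym NE opprK.
move=> _ [Z ZKC <-]; rewrite lerNl -NE; apply: mub.
by exists Z.
Qed.

Lemma frobenius_diag (R : realType) n (A X : 'M[R]_n) :
  is_diag_mx A -> frobenius A X = \sum_i A i i * X i i.
Proof.
move=> /is_diag_mxP dA; rewrite frobeniusE; apply: eq_bigr => i _.
rewrite (bigD1 i) //= big1 ?addr0 // => j ji.
by rewrite dA ?mul0r.
Qed.

(** * The averaging inequality *)

Theorem theorem10 (R : realType) (n : nat) (A : 'M[R]_n)
    (C : set 'rV[R]_('C(n, 2))) :
  is_diag_mx A ->
  \det A < 0 ->
  C `<=` @pi_T R n @` op_ball R n ->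
  C !=set0 ->
  closed C ->
  convex_set C ->
  exists maxSO maxB minB : R,
    [/\ is_max (objective_values A (SO R n) C) maxSO,
        is_max (objective_values A (op_ball R n) C) maxB,
        is_min (objective_values A (op_ball R n) C) minB &
        maxSO >= (1 - n%:R^-1) * maxB + n%:R^-1 * minB].
Proof.
move=> dA detA Cball [T0 CT0] cC _.
have [X0 X0ball X0T] := Cball _ CT0; rewrite -X0T in CT0.
(* A determinant of size 0 is 1, which is not negative. *)
have n0 : 0 < n%:R :> R.
  rewrite ltr0n lt0n; apply/eqP => n0; move: detA; move: A dA.
  by rewrite n0 => B _; rewrite det_mx00 ltr10.
have [Q0 [Q0Q dQ0 Q0X _]] := max_completion ((op_ballP X0).1 X0ball).
have [maxSO hSO] : exists m, is_max (objective_values A (SO R n) C) m.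
  apply: (@objective_max _ _ A _ _ Q0 (@compact_SO R n) cC) => //.
  by rewrite (pi_T_eqP Q0 X0).2.
have [maxB hB] := objective_max A (@compact_op_ball R n) cC X0ball CT0.
have [minB hm] := objective_min A (@compact_op_ball R n) cC X0ball CT0.
exists maxSO, maxB, minB; split => //.
have [[X [/op_ballP hX CX] XB] _] := hB.
have detE : \det A = \prod_i A i i by rewrite det_trig // is_diag_mx_is_trig.
pose s i := Num.sg (A i i).
have As i : A i i = `|A i i| * s i by rewrite mulrC -numEsg.
have s1 i : s i ^+ 2 = 1.
  rewrite /s sqr_sg; case: eqP => // Ai0.
  by move: detA; rewrite detE (bigD1 i) //= Ai0 mul0r ltxx.
have ps : \prod_i s i = -1.
  transitivity (Num.sg (\det A)); last by rewrite ltr0_sg.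
  rewrite detE; apply/esym; elim/big_rec2: _ => [|i x y _ <-].
    by rewrite sgr1.
  by rewrite sgrM.
have [Qm [QmQ _ QmX Qmin]] := @signed_max_completion R n X (fun i => - s i) hX
  (fun i => etrans (sqrrN _) (s1 i)).
have Qm_min : minB <= frobenius A Qm.
  apply: hm.2; exists Qm => //; split; first exact/op_ballP/contraction_orth.
  by rewrite /= (pi_T_eqP Qm X).2.
have row i : \sum_(k | k != i) A k k * X k k + A i i * Qm i i <= maxSO.
  pose si k := if k == i then - s k else s k.
  have si1 k : si k ^+ 2 = 1 by rewrite /si; case: ifP; rewrite ?sqrrN s1.
  have [Q [QQ dQ QX Qmax]] := signed_max_completion hX si1.
  have QSO : SO R n Q.
    split=> //; rewrite dQ -[RHS]opprK -ps [in RHS](bigD1 i) //= (bigD1 i) //=.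
    rewrite {1}/si eqxx mulNr; congr (- (_ * _)).
    by apply: eq_bigr => k /negPf ki; rewrite /si ki.
  apply: (@le_trans _ _ (frobenius A Q)); last first.
    apply: hSO.2; exists Q => //; split => //=.
    by rewrite (pi_T_eqP Q X).2.
  (* The i-th term is bounded through [Qmin] at [Q], the others through [Qmax] at [X]. *)
  rewrite frobenius_diag // [leRHS](bigD1 i) //= addrC; apply: lerD; last first.
    rewrite As -!mulrA ler_wpM2l //.
    have := Qmin Q (contraction_orth QQ) QX i.
    by rewrite !mulNr lerN2.
  apply: ler_sum => k ki; rewrite As -!mulrA ler_wpM2l //.
  by have := Qmax X hX (fun _ _ _ => erefl) k; rewrite /si (negPf ki).
(* Summing [row] over i counts each A k k * X k k exactly n - 1 times, and the terms A i i * Qm i i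
   add up to <A, Qm>, which is at least [minB]. *)
have tot : n%:R * maxB - maxB + minB <= n%:R * maxSO.
  apply: (@le_trans _ _ (\sum_i (\sum_(k | k != i) A k k * X k k + A i i * Qm i i))).
    rewrite big_split /= -(frobenius_diag Qm dA) lerD //.
    under eq_bigr => i _.
      rewrite (_ : \sum_(_ | _) _ = maxB - A i i * X i i); first over.
      by rewrite -XB frobenius_diag // [X in X - _](bigD1 i) //= addrAC subrr add0r.
    rewrite big_split /= sumr_const card_ord sumrN -(frobenius_diag X dA) XB.
    by rewrite mulr_natl.
  rewrite mulr_natl -[X in _ *+ X](card_ord n) -sumr_const.
  exact: ler_sum.
rewrite -(ler_pM2l n0); apply: le_trans tot.
rewrite mulrDr !mulrA mulrBr mulr1 mulfV ?lt0r_neq0 // mul1r mulrBl mul1r.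
by [].
Qed.
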